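(* For every prime power $q$, $s_{q^4}(4,3)\leq 6q+5$.
   Context: Let $\mathcal{S}$ be a point set of $\mathrm{PG}(N,Q)$. A point $P$ is $\rho$-saturated by $\mathcal{S}$ if there is a subspace through $P$ of dimension at most $\rho$ spanned by points of $\mathcal{S}$. $\mathcal{S}$ is a $\rho$-saturating set if $\rho$ is the least integer such that all points of $\mathrm{PG}(N,Q)$ are $\rho$-saturated by $\mathcal{S}$. $s_Q(N,\rho)$ is the smallest size of a $\rho$-saturating set of $\mathrm{PG}(N,Q)$. Here $Q=q^4$. *)

(* Defs.v *)
From HB Require Import structures.
From mathcomp Require Import all_boot all_order all_algebra all_field.

Set Implicit Arguments.
Unset Strict Implicit.
Unset Printing Implicit Defensive.

Import GRing.Theory.

(* Subspaces of a vector space over a finite field are encoded by canonical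
   matrices, so there are finitely many of them. *)
Section FiniteVspace.

Import VectorInternalTheory.

Variables (F : finFieldType) (V : vectType F).

HB.instance Definition _ := [Countable of {vspace V} by <:].
HB.instance Definition _ := [Finite of {vspace V} by <:].

End FiniteVspace.

Section ProjectiveSpace.

Variables (F : finFieldType) (N : nat).

Definition PG_point := {U : {vspace 'rV[F]_N.+1} | \dim U == 1}.

HB.instance Definition _ := SubFinite.on PG_point.

Definition PG_span (T : {set PG_point}) : {vspace 'rV[F]_N.+1} :=
  (\sum_(X in T) val X)%VS.

(* A vector subspace W is a projective subspace of dimension (\dim W).-1, with
   dimension -1 for W = 0: projective dimension at most rho is
   \dim W <= rho.+1. *)
Definition saturated_by (S : {set PG_point}) (rho : nat) (P : PG_point) : bool :=
  [exists T : {set PG_point},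
    [&& T \subset S, \dim (PG_span T) <= rho.+1 & (val P <= PG_span T)%VS]].

Definition saturates_all (rho : nat) (S : {set PG_point}) : bool :=
  [forall P, saturated_by S rho P].

(* Only natural numbers need be considered for the minimality of rho: PG(N, Q)
   has a point, and a subspace through a point has dimension at least 0. *)
Definition saturating_set (rho : nat) (S : {set PG_point}) : bool :=
  saturates_all rho S && [forall r : 'I_rho, ~~ saturates_all r S].

(* The default value #|PG_point|, the number of all points, is taken only when
   no proper subset is a rho-saturating set; see saturation_numberP. *)
Definition saturation_number (rho : nat) : nat :=
  \big[minn/#|{: PG_point}|]_(S : {set PG_point} | saturating_set rho S) #|S|.

Lemma saturation_number_le (rho : nat) (S : {set PG_point}) :
  saturating_set rho S -> saturation_number rho <= #|S|.
Proof.
move=> satS; rewrite /saturation_number.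
elim: (index_enum _) (mem_index_enum S) => //= A s IHs.
rewrite inE big_cons => /predU1P[<-|/IHs le_s]; first by rewrite satS geq_minl.
by case: ifP => // _; rewrite (leq_trans (geq_minr _ _)).
Qed.

Lemma saturation_numberP (rho : nat) :
  (exists S, saturating_set rho S) ->
  exists2 S, saturating_set rho S & #|S| = saturation_number rho.
Proof.
case=> S0 satS0; have le0 := saturation_number_le satS0.
have [//|n_card] : (exists2 S, saturating_set rho S
    & #|S| = saturation_number rho) \/ saturation_number rho = #|{: PG_point}|.
  rewrite /saturation_number.
  elim/big_ind: (\big[_/_]_(_ | _) _) => [|m n Pm Pn|S satS]; first by right.
  - by rewrite /minn; case: ifP.
  - by left; exists S.
by exists S0 => //; apply/eqP; rewrite eqn_leq le0 andbT n_card max_card.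
Qed.

End ProjectiveSpace.

(* Main.v *)
From HB Require Import structures.
Require Import Defs.
From mathcomp Require Import all_boot all_order all_algebra all_field.
From mathcomp Require Import ring zify.

(* Let K be the subfield of F with q elements.  As F has degree 4 over K, the
   five coordinates of a vector v of F^5 satisfy a linear relation over K, so v
   lies in the span of a hyperplane H of K^5.  If S is a set of points of
   PG(4, q) that meets every hyperplane in a spanning set, then v is in the span
   of S inside H, and S is 3-saturating; it is not 2-saturating, because some v
   satisfies only one relation over K up to a factor.

   For q > 2 such an S is the union of six lines, two of which intersect: if the
   points of S in H do not span H, then some plane meets all six lines.  Such a
   plane either contains the common point of the two lines, and then yields a
   root of a quadratic polynomial over K, or it meets the plane of the two lines
   in a line, and then yields a root of a cubic polynomial.  The lines are chosen
   so that neither polynomial has a root in K; the polynomials come from the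
   non-injective, hence non-surjective, maps t^2 - t and t^3 - t.  This
   needs an element of K other than 0 and 1; for q = 2, let S consist of the 15
   points e_i and e_i + e_j. *)

Set Implicit Arguments.
Unset Strict Implicit.
Unset Printing Implicit Defensive.

Import GRing.Theory.
Local Open Scope ring_scope.

(** * Parallel vectors and linear combinations of equations *)

Lemma parallel_pair (K : fieldType) (x y x' y' : K) :
  x * y' = y * x' ->
  exists s t c c', [/\ (s, t) != (0, 0), x = c * s, y = c * t,
                       x' = c' * s & y' = c' * t].
Proof.
move=> E; have [x0|x0] := eqVneq x 0; last first.
  exists x, y, 1, (x' / x); split; rewrite ?mul1r ?divfK //.
    by apply: contra x0 => /eqP[->].
  by apply: (mulfI x0); rewrite E; field.
have [y0|y0] := eqVneq y 0; last first.
  exists x, y, 1, (y' / y); split; rewrite ?mul1r ?divfK //.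
    by apply: contra y0 => /eqP[_ ->].
  by apply: (mulfI y0); rewrite -E; field.
have [x'0|x'0] := eqVneq x' 0; last first.
  exists x', y', 0, 1; split; rewrite ?mul1r ?mul0r //.
  by apply: contra x'0 => /eqP[->].
have [y'0|y'0] := eqVneq y' 0; last first.
  exists x', y', 0, 1; split; rewrite ?mul1r ?mul0r //.
  by apply: contra y'0 => /eqP[_ ->].
exists 1, 1, 0, 0; split; rewrite ?mul0r //.
by apply/negP => /eqP[/eqP]; rewrite oner_eq0.
Qed.

(** Proves [x = y] from a certificate: [l = r] is a linear combination of known equations, built
    with [+e] and [*e], and the remaining goal is a ring identity. *)
Lemma eq_of_sub (V : zmodType) (x y l r : V) : l = r -> x - y = l - r -> x = y.
Proof. by move=> -> /eqP; rewrite subrr subr_eq0 => /eqP. Qed.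

Local Notation "E +e F" := (congr2 +%R E F) (at level 50, left associativity).
Local Notation "c *e E" := (congr1 ( *%R c) E) (at level 40).

(** * Two functionals that are dependent on each of six lines *)

Section SixLines.

Variables (K : fieldType) (n a e k g1 g2 d1 d2 : K).
Let w := (n - 1) * e.

Hypothesis n1 : n != 1.
Hypothesis quad : forall t, t ^+ 2 + (a - e) * t - a != 0.
Hypothesis cubic : forall t, t ^+ 3 - t != k.
Hypothesis Eg1 : n * g1 = -1.
Hypothesis Eg2 : n * g2 - w * g1 = - a.
Hypothesis Ed1 : w * (d2 - d1) = a ^+ 2 + a - 1.
Hypothesis Ed2 : w * d2 = - (a ^+ 2 + k) - a * (a ^+ 2 + a - 1).

(* The functionals u and b are linearly dependent on each of the six lines of
   [six_lines] below.  The coordinates of the lines come from the following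
   normalization: e1 is the common point of the first two lines, e1, e2, e3 span
   their plane, and modulo e1 the other four lines are the graphs {(x, B x)} over
   <e2, e3> of the matrices B = infinity, 1, [n, w; 0, n] and [a + 1, a; 1, 1].
   Planes through e1 then correspond to the roots of [quad].  The e1-coordinates
   g1, g2, d1, d2 are chosen to turn the form for the other planes into [cubic]. *)
Definition six_lines_conditions (u1 u2 u3 u4 u5 b1 b2 b3 b4 b5 : K) :=
  [/\ u2 * b1 = u1 * b2, u3 * b1 = u1 * b3 & u4 * b5 = u5 * b4] /\
  [/\ (u2 + u4) * (b3 + b5) = (u3 + u5) * (b2 + b4),
  (u2 + n * u4 + g1 * u1) * (b3 + w * b4 + n * b5 + g2 * b1)
  = (u3 + w * u4 + n * u5 + g2 * u1) * (b2 + n * b4 + g1 * b1) &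
  (u2 + (a + 1) * u4 + u5 + d1 * u1) * (b3 + a * b4 + b5 + d2 * b1)
  = (u3 + a * u4 + u5 + d2 * u1) * (b2 + (a + 1) * b4 + b5 + d1 * b1)].

(** The functional [b1 u - u1 b] vanishes on the plane of the first two lines, so it is
    [(0, 0, 0, s, t)], and on the other four lines it is still dependent with [b]. If [(s, t)] were
    nonzero, its direction [(x, y)] would be a zero of the homogenized cubic. *)
Lemma six_lines_off_vertex u1 u2 u3 u4 u5 b1 b2 b3 b4 b5 :
    six_lines_conditions u1 u2 u3 u4 u5 b1 b2 b3 b4 b5 -> b1 != 0 ->
  u4 * b1 = u1 * b4 /\ u5 * b1 = u1 * b5.
Proof.
case=> -[E1 E2 E3] [E4 E5 E6] b10.
suff [s0 t0] : b1 * u4 - u1 * b4 = 0 /\ b1 * u5 - u1 * b5 = 0.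
  by split; rewrite mulrC; apply/eqP; rewrite -subr_eq0; apply/eqP.
set s := _ - _; set t := _ - _.
have F3 : s * b5 = t * b4 by apply: eq_of_sub (b1 *e E3) _; rewrite /s /t; ring.
have F4 : s * b3 = t * b2.
  apply: eq_of_sub
    (b1 *e E4 +e (- (b3 + b5)) *e E1 +e (b2 + b4) *e E2 +e (-1) *e F3) _.
  by rewrite /s /t; ring.
have F5 : n * s * (b3 + w * b4 + n * b5 + g2 * b1)
    = (w * s + n * t) * (b2 + n * b4 + g1 * b1).
  apply: eq_of_sub (b1 *e E5 +e (- (b3 + w * b4 + n * b5 + g2 * b1)) *e E1
    +e (b2 + n * b4 + g1 * b1) *e E2) _.
  by rewrite /s /t; ring.
have F6 : ((a + 1) * s + t) * (b3 + a * b4 + b5 + d2 * b1)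
    = (a * s + t) * (b2 + (a + 1) * b4 + b5 + d1 * b1).
  apply: eq_of_sub (b1 *e E6 +e (- (b3 + a * b4 + b5 + d2 * b1)) *e E1
    +e (b2 + (a + 1) * b4 + b5 + d1 * b1) *e E2) _.
  by rewrite /s /t; ring.
have [x [y [c [c' [xy0 Es Et Eb2 Eb3]]]]] := parallel_pair F4.
clearbody s t; rewrite {}Es {}Et {}Eb2 {}Eb3 {F4 E1 E2 E3 E4 E5 E6} in F3 F5 F6 *.
have [->|c0] := eqVneq c 0; first by rewrite !mul0r.
have G3 : x * b5 = y * b4.
  by apply: (mulfI c0); rewrite !mulrA.
case/negP: xy0; apply/eqP.
have G5 : b1 * (y - a * x) = c' * w * x ^+ 2.
  apply: (mulfI c0); apply: eq_of_sub (F5 +e (- (c * n ^+ 2)) *e G3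
    +e (- (c * b1 * x)) *e Eg2 +e (c * b1 * y) *e Eg1) _.
  by ring.
have G6 : b1 * (d2 * ((a + 1) * x + y) - d1 * (a * x + y))
    = - (c' * (y ^+ 2 + a * x * y - a * x ^+ 2)).
  apply: (mulfI c0); apply: eq_of_sub (F6 +e (- c) *e G3) _.
  by ring.
(* The first two terms of the combination eliminate [c']; [Ed1] and [Ed2] then remove [d1] and
   [d2]. *)
have G : y ^+ 3 = y * x ^+ 2 + k * x ^+ 3.
  apply: (mulfI b10); apply: eq_of_sub
    ((y ^+ 2 + a * x * y - a * x ^+ 2) *e G5 +e (w * x ^+ 2) *e G6
     +e (- (b1 * x ^+ 3)) *e Ed2 +e (- (b1 * x ^+ 2 * (a * x + y))) *e Ed1) _.
  by ring.
have [x0|x0] := eqVneq x 0.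
  by move/eqP: G; rewrite x0 !expr0n !mulr0 addr0 expf_eq0 => /eqP->.
case/negP: (cubic (y / x)); apply/eqP.
apply: (mulIf (expf_neq0 3 x0)); apply: eq_of_sub G _.
by field.
Qed.

(** The third and fourth lines give directions [(x, y)] and [(x', y')] in terms of which all the
    minors are multiples of [d * c' - c * d']. If this factor is nonzero, the last two lines give
    two linear equations in [(x', y')], whose determinant is the homogenized quadratic. *)
Lemma six_lines_at_vertex u2 u3 u4 u5 b2 b3 b4 b5 :
    six_lines_conditions 0 u2 u3 u4 u5 0 b2 b3 b4 b5 ->
  [/\ u2 * b3 = u3 * b2, u2 * b4 = u4 * b2, u2 * b5 = u5 * b2,
      u3 * b4 = u4 * b3 & u3 * b5 = u5 * b3].
Proof.
case=> -[_ _ E3] [E4 E5 E6].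
have [x [y [c [c' [xy0 Eu4 Eu5 Eb4 Eb5]]]]] := parallel_pair E3.
have [x' [y' [d [d' [xy'0 Eu2 Eu3 Eb2 Eb3]]]]] := parallel_pair E4.
have {}Eu2 : u2 = d * x' - c * x by rewrite -Eu2 Eu4 addrK.
have {}Eu3 : u3 = d * y' - c * y by rewrite -Eu3 Eu5 addrK.
have {}Eb2 : b2 = d' * x' - c' * x by rewrite -Eb2 Eb4 addrK.
have {}Eb3 : b3 = d' * y' - c' * y by rewrite -Eb3 Eb5 addrK.
subst u2 u3 u4 u5 b2 b3 b4 b5.
have [D|D] := eqVneq (d * c' - c * d') 0.
  split; [apply: eq_of_sub ((x * y' - y * x') *e D) _
         |apply: eq_of_sub ((x * x') *e D) _
         |apply: eq_of_sub ((y * x') *e D) _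
         |apply: eq_of_sub ((x * y') *e D) _
         |apply: eq_of_sub ((y * y') *e D) _]; ring.
have nn0 : n - 1 != 0 by rewrite subr_eq0.
have F5 : x' * (e * x + y) = y' * x.
  apply: (mulfI D); apply: (mulfI nn0); apply: eq_of_sub E5 _.
  by rewrite /w; ring.
have F6 : x' * (a * x) = y' * (a * x + y).
  by apply: (mulfI D); apply: eq_of_sub E6 _; ring.
have G : (y + e * x) ^+ 2 + (a - e) * (y + e * x) * x = a * x ^+ 2.
  have [x'0|x'0] := eqVneq x' 0.
    have y'0 : y' != 0 by apply: contra xy'0 => /eqP->; rewrite x'0.
    apply: (mulfI y'0).
    by apply: eq_of_sub ((- (y + e * x)) *e F6 +e (a * x) *e F5) _; ring.
  apply: (mulfI x'0).
  by apply: eq_of_sub ((- x) *e F6 +e (a * x + y) *e F5) _; ring.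
case/negP: xy0; apply/eqP; have [x0|x0] := eqVneq x 0.
  move/eqP: G; rewrite x0 !mulr0 !addr0 expr0n /= mulr0 expf_eq0 /= => /eqP->.
  by [].
case/negP: (quad ((y + e * x) / x)); apply/eqP.
apply: (mulIf (expf_neq0 2 x0)); apply: eq_of_sub G _.
by field.
Qed.

End SixLines.

Definition dot (R : pzRingType) m (u x : 'rV[R]_m) : R :=
  \sum_j u 0 j * x 0 j.

Lemma dotDZr (R : comPzRingType) m (u x y : 'rV[R]_m) c :
  dot u (x + c *: y) = dot u x + c * dot u y.
Proof.
rewrite /dot mulr_sumr -big_split; apply: eq_bigr => j _.
by rewrite !mxE mulrDr mulrCA.
Qed.

Lemma dotC (R : comPzRingType) m (x y : 'rV[R]_m) : dot x y = dot y x.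
Proof. by apply: eq_bigr => i _; rewrite mulrC. Qed.

Lemma dotZl (R : comPzRingType) m c (x y : 'rV[R]_m) :
  dot (c *: x) y = c * dot x y.
Proof. by rewrite /dot mulr_sumr; apply: eq_bigr => i _; rewrite mxE mulrA. Qed.

Lemma dot_suml (R : pzRingType) m (I : Type) (r : seq I) (P : pred I)
    (x : I -> 'rV[R]_m) y :
  dot (\sum_(i <- r | P i) x i) y = \sum_(i <- r | P i) dot (x i) y.
Proof.
rewrite /dot exchange_big; apply: eq_bigr => j _.
by rewrite summxE mulr_suml.
Qed.

Lemma dot_row_mx (R : pzRingType) m1 m2 (x1 y1 : 'rV[R]_m1) (x2 y2 : 'rV[R]_m2) :
  dot (row_mx x1 x2) (row_mx y1 y2) = dot x1 y1 + dot x2 y2.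
Proof.
rewrite /dot big_split_ord /=; congr (_ + _); apply: eq_bigr => i _.
  by rewrite !row_mxEl.
by rewrite !row_mxEr.
Qed.

Lemma dot_delta (R : pzRingType) m (u : 'rV[R]_m) i : dot u (delta_mx 0 i) = u 0 i.
Proof.
rewrite /dot (bigD1 i) //= mxE !eqxx mulr1 big1 ?addr0 // => j /negPf ji.
by rewrite mxE ji andbF mulr0.
Qed.

(* Every hyperplane u = 0 is spanned by the points of s that it contains; the
   conclusion says that u and b are parallel, and holds trivially for u = 0. *)
Definition strong_blocking (K : fieldType) m (s : seq 'rV[K]_m) :=
  forall u b : 'rV[K]_m, (forall x, x \in s -> dot u x = 0 -> dot b x = 0) ->
  forall i j, u 0 i * b 0 j = u 0 j * b 0 i.

Section Lines.

Variables (K : finFieldType) (m : nat).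
Implicit Types (u b x y : 'rV[K]_m).

(* The points of the line through x and y other than y. *)
Definition affine_line x y : seq 'rV[K]_m := [seq x + c *: y | c <- enum K].

Lemma size_affine_line x y : size (affine_line x y) = #|K|.
Proof. by rewrite size_map -cardT. Qed.

(** If [u] is nonzero at [y], its zero on the line is [x - (u.x / u.y) y], where [b] must vanish
    too. *)
Lemma dot_line_parallel u b x y :
    (forall z, z \in y :: affine_line x y -> dot u z = 0 -> dot b z = 0) ->
  dot u x * dot b y = dot u y * dot b x.
Proof.
move=> ub; have [uy0|uy0] := eqVneq (dot u y) 0.
  by rewrite uy0 (ub y) ?mem_head // mulr0 mul0r.
have zl c : x + c *: y \in y :: affine_line x y.
  by rewrite inE; apply/orP; right; apply/mapP; exists c; rewrite ?mem_enum.
have := ub _ (zl (- (dot u x / dot u y))).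
rewrite !dotDZr mulNr divfK // subrr => /(_ erefl)/eqP.
rewrite mulNr subr_eq0 => /eqP->.
by field.
Qed.

End Lines.

Definition row5 (R : nmodType) (x1 x2 x3 x4 x5 : R) : 'rV[R]_5 :=
  \row_(j < 5) [:: x1; x2; x3; x4; x5]`_j.

Lemma row5P (R : nmodType) (u : 'rV[R]_5) :
  exists u1 u2 u3 u4 u5, u = row5 u1 u2 u3 u4 u5.
Proof.
exists (u 0 (inord 0)), (u 0 (inord 1)), (u 0 (inord 2)), (u 0 (inord 3)).
exists (u 0 (inord 4)); apply/rowP => j; rewrite !mxE.
case: j => [[|[|[|[|[|//]]]]] Hj] /=;
  by congr (u 0 _); apply: val_inj; rewrite /= inordK.
Qed.

Lemma dot_row5 (R : pzRingType) (u1 u2 u3 u4 u5 x1 x2 x3 x4 x5 : R) :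
  dot (row5 u1 u2 u3 u4 u5) (row5 x1 x2 x3 x4 x5)
  = u1 * x1 + u2 * x2 + u3 * x3 + u4 * x4 + u5 * x5.
Proof. by rewrite /dot !big_ord_recl big_ord0 !mxE /= addr0 !addrA. Qed.

Lemma row5_parallel (R : comPzRingType)
    (u1 u2 u3 u4 u5 b1 b2 b3 b4 b5 : R) :
    [/\ u2 * b1 = u1 * b2, u3 * b1 = u1 * b3, u4 * b1 = u1 * b4,
        u5 * b1 = u1 * b5 & u4 * b5 = u5 * b4] /\
    [/\ u2 * b3 = u3 * b2, u2 * b4 = u4 * b2, u2 * b5 = u5 * b2,
        u3 * b4 = u4 * b3 & u3 * b5 = u5 * b3] ->
  let u := row5 u1 u2 u3 u4 u5 in let b := row5 b1 b2 b3 b4 b5 in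
  forall i j, u 0 i * b 0 j = u 0 j * b 0 i.
Proof.
move=> [[E1 E2 E3 E4 E5] [F1 F2 F3 F4 F5]] u b i j; rewrite !mxE.
case: i j => [[|[|[|[|[|//]]]]] ?] [[|[|[|[|[|//]]]]] ?] //=.
Qed.

(** * Choice of the parameters and the blocking set for [q > 2] *)

Lemma nonsurjective (T : finType) (f : T -> T) (x y : T) :
  x != y -> f x = f y -> exists z, forall t, f t != z.
Proof.
move=> xy fxy; have [z zP|zP] := pickP (fun z => z \notin codom f).
  by exists z => t; apply: contra zP => /eqP<-; apply: codom_f.
suff /injectiveP inj_f : injectiveb f by case/eqP: xy; apply: inj_f.
apply/card_uniqP; rewrite size_map -cardT; apply: eq_card => z.
by rewrite inE; apply/negbFE/zP.
Qed.

Lemma exists_notin2 (K : finFieldType) (x y : K) :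
  (2 < #|K|)%N -> exists c, c != x /\ c != y.
Proof.
move=> K2; suff : exists c, c \notin [:: x; y].
  by case=> c; rewrite !inE negb_or => /andP[]; exists c.
have [c cP|cP] := pickP (fun c => c \notin [:: x; y]); first by exists c.
have : (#|K| <= #|[:: x; y]|)%N.
  by apply/subset_leq_card/subsetP => c _; have := cP c; move/negbFE.
by move=> /leq_trans/(_ (card_size _)); rewrite leqNgt K2.
Qed.

Lemma six_lines_parameters (K : finFieldType) : (2 < #|K|)%N ->
  exists n a e k g1 g2 d1 d2 : K, let w := (n - 1) * e in
  [/\ n != 1, forall t, t ^+ 2 + (a - e) * t - a != 0
    & forall t, t ^+ 3 - t != k] /\
  [/\ n * g1 = -1, n * g2 - w * g1 = - a, w * (d2 - d1) = a ^+ 2 + a - 1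
    & w * d2 = - (a ^+ 2 + k) - a * (a ^+ 2 + a - 1)].
Proof.
move=> K2; have [n [n0 n1]] := exists_notin2 0 1 K2.
have [k kP] : exists k : K, forall t, t ^+ 3 - t != k.
  by apply: (@nonsurjective _ _ 0 1); rewrite 1?eq_sym ?oner_eq0 //; ring.
have [l lP] : exists l : K, forall t, t ^+ 2 - t != l.
  by apply: (@nonsurjective _ _ 0 1); rewrite 1?eq_sym ?oner_eq0 //; ring.
have l0 : l != 0 by apply: contraNneq (lP 0) => ->; apply/eqP; ring.
(* With [a - e = - c] and [a = c^2 l], the quadratic at [t] is [c^2] times [T^2 - T - l] at
   [T = t / c]. Avoiding [- l^-1] makes [e] nonzero, so that the linear equations for [d1] and [d2]
   can be solved. *)
have [c [c0 cl]] := exists_notin2 0 (- l^-1) K2.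
pose a := c ^+ 2 * l; pose e := a + c; pose w := (n - 1) * e.
have e0 : e != 0.
  have -> : e = c * l * (c + l^-1) by rewrite /e /a; field.
  by rewrite !mulf_neq0 // addr_eq0.
have w0 : w != 0 by rewrite mulf_neq0 // subr_eq0.
pose d2 := (- (a ^+ 2 + k) - a * (a ^+ 2 + a - 1)) / w.
exists n, a, e, k, (- n^-1), ((- a - w / n) / n).
exists (d2 - (a ^+ 2 + a - 1) / w), d2.
split; split=> //; rewrite -?/w; try by rewrite /d2; field; rewrite ?n0 ?w0.
move=> t; apply: contra (lP (t / c)) => /eqP tP; apply/eqP.
apply: (mulfI (expf_neq0 2 c0)); apply: eq_of_sub tP _.
by rewrite /e /a; field.
Qed.

Lemma six_lines_parallel (K : fieldType)
    (n a e k g1 g2 d1 d2 u1 u2 u3 u4 u5 b1 b2 b3 b4 b5 : K) :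
    let w := (n - 1) * e in
    n != 1 -> (forall t, t ^+ 2 + (a - e) * t - a != 0) ->
    (forall t, t ^+ 3 - t != k) ->
    n * g1 = -1 -> n * g2 - w * g1 = - a ->
    w * (d2 - d1) = a ^+ 2 + a - 1 ->
    w * d2 = - (a ^+ 2 + k) - a * (a ^+ 2 + a - 1) ->
    six_lines_conditions n a e g1 g2 d1 d2 u1 u2 u3 u4 u5 b1 b2 b3 b4 b5 ->
  let u := row5 u1 u2 u3 u4 u5 in let b := row5 b1 b2 b3 b4 b5 in
  forall i j, u 0 i * b 0 j = u 0 j * b 0 i.
Proof.
move=> w n1 quad cubic Eg1 Eg2 Ed1 Ed2.
have off u1' u2' u3' u4' u5' b1' b2' b3' b4' b5' : b1' != 0 ->
    six_lines_conditions n a e g1 g2 d1 d2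
      u1' u2' u3' u4' u5' b1' b2' b3' b4' b5' ->
  let u := row5 u1' u2' u3' u4' u5' in let b := row5 b1' b2' b3' b4' b5' in
  forall i j, u 0 i * b 0 j = u 0 j * b 0 i.
  move=> b10 C; case: (C) => -[E1 E2 _] _.
  have [E3 E4] := six_lines_off_vertex cubic Eg1 Eg2 Ed1 Ed2 C b10.
  have bK x y : x * b1' = u1' * y -> x = u1' / b1' * y.
    by move=> E; apply: (mulIf b10); rewrite E; field.
  apply: row5_parallel.
  rewrite {}(bK _ _ E1) {}(bK _ _ E2) {}(bK _ _ E3) {}(bK _ _ E4).
  by split; split; field.
move=> C; have [b10|/off] := eqVneq b1 0; last exact.
have [u10|u10] := eqVneq u1 0.
  subst b1 u1; have [F1 F2 F3 F4 F5] := six_lines_at_vertex n1 quad C.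
  case: C => -[_ _ E3] _; apply: row5_parallel.
  by split; split; rewrite ?mul0r ?mulr0.
(* The conditions are symmetric in [u] and [b]; here [u1] is nonzero, so the two are exchanged. *)
move=> u b i j; rewrite [LHS]mulrC [RHS]mulrC.
apply: (off _ _ _ _ _ _ _ _ _ _ u10 _ j i).
by case: C => -[E1 E2 E3] [E4 E5 E6]; split; split; rewrite mulrC 1?[RHS]mulrC.
Qed.

(** The common point [e1] of the first two lines is listed once, so the length is
    [1 + 2q + 4(q + 1) = 6q + 5]. *)
Definition six_lines (K : finFieldType) (n a e g1 g2 d1 d2 : K) :=
  let w := (n - 1) * e in
  let e1 := row5 1 0 0 0 0 in
  let line x y := y :: affine_line x y in
  e1 :: affine_line (row5 0 1 0 0 0) e1 ++ affine_line (row5 0 0 1 0 0) e1 ++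
  line (row5 0 0 0 1 0) (row5 0 0 0 0 1) ++
  line (row5 0 1 0 1 0) (row5 0 0 1 0 1) ++
  line (row5 g1 1 0 n 0) (row5 g2 0 1 w n) ++
  line (row5 d1 1 0 (a + 1) 1) (row5 d2 0 1 a 1).

Lemma six_lines_strong_blocking (K : finFieldType) : (2 < #|K|)%N ->
  exists s : seq 'rV[K]_5, strong_blocking s /\ size s = (6 * #|K| + 5)%N.
Proof.
move=> K2; have [n [a [e [k [g1 [g2 [d1 [d2]]]]]]]] := six_lines_parameters K2.
move=> [[n1 quad cubic] [Eg1 Eg2 Ed1 Ed2]].
exists (six_lines n a e g1 g2 d1 d2); split; last first.
  by rewrite /six_lines; do 6 rewrite /= ?size_cat ?size_affine_line; lia.
move=> u b; have [u1 [u2 [u3 [u4 [u5 ->]]]]] := row5P u.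
have [b1 [b2 [b3 [b4 [b5 ->]]]]] := row5P b => {u b} ub.
have C : six_lines_conditions n a e g1 g2 d1 d2 u1 u2 u3 u4 u5 b1 b2 b3 b4 b5.
  have L x y : {subset y :: affine_line x y <= six_lines n a e g1 g2 d1 d2} ->
      dot (row5 u1 u2 u3 u4 u5) x * dot (row5 b1 b2 b3 b4 b5) y
      = dot (row5 u1 u2 u3 u4 u5) y * dot (row5 b1 b2 b3 b4 b5) x.
    by move=> sub; apply: dot_line_parallel => z /sub; apply: ub.
  (* The default of [nth] is itself one of the lines, so the inclusion holds for every index. *)
  have sub i x y : nth (row5 0 1 0 0 0, row5 1 0 0 0 0) [::
      (row5 0 1 0 0 0, row5 1 0 0 0 0); (row5 0 0 1 0 0, row5 1 0 0 0 0);
      (row5 0 0 0 1 0, row5 0 0 0 0 1); (row5 0 1 0 1 0, row5 0 0 1 0 1);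
      (row5 g1 1 0 n 0, row5 g2 0 1 ((n - 1) * e) n);
      (row5 d1 1 0 (a + 1) 1, row5 d2 0 1 a 1)] i = (x, y) ->
    {subset y :: affine_line x y <= six_lines n a e g1 g2 d1 d2}.
    case: i => [|[|[|[|[|[|i]]]]]] /=; rewrite ?nth_nil => -[<- <-] z;
      by rewrite /six_lines !(inE, mem_cat) => /orP[]->; rewrite ?orbT.
  split; split; [apply: eq_of_sub (L _ _ (sub 0 _ _ erefl)) _
   |apply: eq_of_sub (L _ _ (sub 1 _ _ erefl)) _
   |apply: eq_of_sub (L _ _ (sub 2 _ _ erefl)) _
   |apply: eq_of_sub (L _ _ (sub 3 _ _ erefl)) _
   |apply: eq_of_sub (L _ _ (sub 4 _ _ erefl)) _
   |apply: eq_of_sub (L _ _ (sub 5 _ _ erefl)) _]; rewrite !dot_row5; ring.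
exact: six_lines_parallel n1 quad cubic Eg1 Eg2 Ed1 Ed2 C.
Qed.

(** * The blocking set for [q = 2] *)

Lemma card2_eq1 (K : finFieldType) (x : K) : #|K| = 2%N -> x != 0 -> x = 1.
Proof.
move=> K2 x0; apply: contraTeq isT => x1.
have : uniq [:: 0; 1; x].
  by rewrite /= !inE !(eq_sym _ x) negb_or x0 x1 eq_sym oner_eq0.
move/card_uniqP => /= c3; have := max_card [in [:: 0; 1; x]].
by rewrite K2 c3.
Qed.

Lemma card2_add11 (K : finFieldType) : #|K| = 2%N -> 1 + 1 = 0 :> K.
Proof.
move=> K2; apply/eqP; apply: contraT => /(card2_eq1 K2)/eqP.
by rewrite -subr_eq0 addrK oner_eq0.
Qed.

(** Over two elements these are the points on the lines joining two basis points. The boolean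
    multiplicity drops the second summand on the diagonal, which leaves the basis vectors
    themselves. *)
Definition tetrahedron (K : fieldType) m : seq 'rV[K]_m :=
  [seq delta_mx 0 ij.1 + delta_mx 0 ij.2 *+ (ij.1 != ij.2)
     | ij : 'I_m * 'I_m in [pred ij : 'I_m * 'I_m | (ij.1 <= ij.2)%N]].

Lemma size_tetrahedron5 (K : fieldType) : size (tetrahedron K 5) = 15.
Proof.
rewrite size_map -cardE -sum1_card.
rewrite -(pair_big_dep xpredT (fun i j : 'I_5 => (i <= j)%N) (fun _ _ => 1%N)) /=.
under eq_bigr do rewrite big_mkcond !big_ord_recl big_ord0 /=.
by rewrite !big_ord_recl big_ord0.
Qed.

(** The basis vectors force [b] to vanish wherever [u] does; the sums force [b] to be constant where
    [u] is 1. *)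
Lemma tetrahedron_strong_blocking (K : finFieldType) m :
  #|K| = 2%N -> strong_blocking (tetrahedron K m).
Proof.
move=> K2 u b ub.
have b0 i : u 0 i = 0 -> b 0 i = 0.
  rewrite -!dot_delta; apply: ub; apply/imageP.
  by exists (i, i); rewrite ?inE //= eqxx addr0.
have bD (i j : 'I_m) : (i < j)%N -> u 0 i + u 0 j = 0 -> b 0 i + b 0 j = 0.
  move=> ij; have dE (v : 'rV[K]_m) : v 0 i + v 0 j
      = dot v (delta_mx 0 i + 1 *: delta_mx 0 j).
    by rewrite dotDZr !dot_delta mul1r.
  rewrite !dE; apply: ub; apply/imageP.
  exists (i, j); rewrite ?inE /= ?(ltnW ij) // scale1r.
  by rewrite -val_eqE /= neq_ltn ij.
suff P (i j : 'I_m) : (i < j)%N -> u 0 i * b 0 j = u 0 j * b 0 i.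
  move=> i j; have [/P//|/P//|/val_inj->//] := ltngtP i j.
move=> ij; have [ui|ui] := eqVneq (u 0 i) 0.
  by rewrite ui (b0 i) // mul0r mulr0.
have [uj|uj] := eqVneq (u 0 j) 0.
  by rewrite uj (b0 j) // mul0r mulr0.
have := bD _ _ ij; rewrite (card2_eq1 K2 ui) (card2_eq1 K2 uj) card2_add11 //.
move=> /(_ erefl)/eqP; rewrite addr_eq0 !mul1r => /eqP->.
apply/eqP; rewrite -subr_eq0 opprK -[b 0 j]mul1r -mulrDl card2_add11 //.
by rewrite mul0r.
Qed.

(** * The subfield with [q] elements *)

Section FixedSubfield.

Variables (F : finFieldType) (q : nat).
Hypothesis charq : [pchar F].-nat q.

(** The predicate carries the proof that makes the [q]-th power map additive, so that the closure
    instance can be inferred from it. *)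
Definition fixed_pred of [pchar F].-nat q : {pred F} :=
  fun x => x ^+ q == x.

Lemma fixed_divring_closed : divring_closed (fixed_pred charq).
Proof.
split=> [|x y|x y]; rewrite !unfold_in ?expr1n // => /eqP xq /eqP yq.
  by rewrite exprDn_pchar // exprNn_pchar // xq yq.
by rewrite exprMn exprVn xq yq.
Qed.

HB.instance Definition _ :=
  GRing.isDivringClosed.Build F (fixed_pred charq) fixed_divring_closed.

Definition fixed_field := {x : F | x \in fixed_pred charq}.

HB.instance Definition _ := SubFinite.on fixed_field.
HB.instance Definition _ := [SubChoice_isSubIntegralDomain of fixed_field by <:].
HB.instance Definition _ := [SubIntegralDomain_isSubField of fixed_field by <:].

(* 'X^q - 'X divides 'X^#|F| - 'X, which vanishes on F: the cofactor has at most
   #|F| - q roots, so at least q points of F are left for 'X^q - 'X. *)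
Lemma card_fixed_field : #|F| = (q ^ 4)%N -> #|{: fixed_field}| = q.
Proof.
move=> cardF; have q_gt1 : (1 < q)%N.
  have := finNzRing_gt1 F; rewrite cardF.
  by case: q => [|[|]] //; rewrite exp1n.
pose P : {poly F} := 'X^q - 'X.
(* [N = (q^4 - 1) / (q - 1)], so the geometric sum [R] is the cofactor of [P]. *)
pose N := (1 + q + q ^ 2 + q ^ 3)%N.
pose R : {poly F} := \sum_(i < N) ('X^(q.-1)) ^+ i.
have sizeXX m : (1 < m)%N -> size ('X^m - 'X : {poly F}) = m.+1.
  by move=> m1; rewrite size_polyDl size_polyXn // size_polyN size_polyX.
have sizeP := sizeXX q q_gt1.
have P0 : P != 0 by rewrite -size_poly_gt0 sizeP.
have PR : P * R = 'X^(q ^ 4) - 'X.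
  have -> : P = 'X * ('X^(q.-1) - 1).
    by rewrite mulrBr mulr1 -exprS prednK // ltnW.
  rewrite -mulrA -subrX1 mulrBr mulr1 -exprM -exprS; congr ('X^_ - _).
  by rewrite /N; nia.
have sizePR : size (P * R) = (q ^ 4).+1.
  by rewrite PR sizeXX // -(exp1n 4) ltn_exp2r.
have R0 : R != 0.
  by apply: contra_eq_neq sizePR => ->; rewrite mulr0 size_poly0.
have sizeR : (q + size R)%N = (q ^ 4).+1.
  by rewrite -sizePR size_mul // sizeP.
rewrite card_sig; set A := [pred x | _].
have le1 : (#|A| < q.+1)%N.
  rewrite -sizeP cardE max_poly_roots ?enum_uniq //.
  apply/allP => x; rewrite mem_enum /= => xA.
  by rewrite /root !hornerE subr_eq0.
have le2 : (#|predC A| < size R)%N.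
  rewrite cardE max_poly_roots ?enum_uniq //.
  apply/allP => x; rewrite mem_enum inE /= => xA.
  have : root (P * R) x by rewrite PR /root !hornerE -cardF expf_card subrr.
  rewrite rootM => /orP[|//]; rewrite /root !hornerE subr_eq0 => xq.
  by case/negP: xA.
have cardA : (#|A| + #|predC A| = q ^ 4)%N by rewrite -cardF -(cardC A).
by lia.
Qed.

End FixedSubfield.

Lemma exists_subfield (F : finFieldType) (p k : nat) :
  prime p -> #|F| = ((p ^ k) ^ 4)%N ->
  exists (K : finFieldType) (f : {rmorphism K -> F}), #|K| = (p ^ k)%N.
Proof.
move=> p_pr cardF.
have charp : p \in [pchar F].
  by apply: card_finPcharP p_pr; rewrite cardF -expnM.
have charq : [pchar F].-nat (p ^ k)%N.
  by rewrite pnatX pnatE // charp.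
exists (fixed_field charq : finFieldType), val.
exact: card_fixed_field.
Qed.

(** * From strong blocking sets over [K] to saturating sets over [F] *)

Section RationalPoints.

Variables (K F : finFieldType) (f : {rmorphism K -> F}).
Hypothesis cardF : #|F| = (#|K| ^ 4)%N.

Local Notation "x ^f" := (map_mx f x) : ring_scope.

Lemma dot_map m (x y : 'rV[K]_m) : dot x^f y^f = f (dot x y).
Proof.
by rewrite rmorph_sum; apply: eq_bigr => i _; rewrite !mxE rmorphM.
Qed.

(** Pigeonhole: there are more than [q^4] rational vectors, so two of them have the same product
    with [v]. *)
Lemma exists_rational_relation m (v : 'rV[F]_m) :
  (4 < m)%N -> exists2 u : 'rV[K]_m, u != 0 & dot v u^f = 0.
Proof.
move=> m4; pose g (u : 'rV[K]_m) := dot v u^f.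
have /injectivePn[x [y xy gxy]] : ~~ injectiveb g.
  apply/negP => /injectiveP/leq_card; apply/negP.
  rewrite -ltnNge card_mx mul1n cardF ltn_exp2l //.
  exact: finNzRing_gt1.
exists (x - y); first by rewrite subr_eq0.
rewrite -[RHS](subrr (g x)) {2}gxy /g /dot -sumrB.
by apply: eq_bigr => j _; rewrite !mxE rmorphB mulrBr.
Qed.

(** Fewer than four elements have fewer than [q^4] combinations over [K], so some [y] in [F] can be
    adjoined. *)
Lemma exists_rationally_free n : (n <= 4)%N ->
  exists v : 'rV[F]_n, forall b : 'rV[K]_n, dot v b^f = 0 -> b = 0.
Proof.
elim: n => [_|n IHn n4]; first by exists 0 => b _; apply/rowP => -[].
have [v vP] := IHn (ltnW n4).
have [y yP] : exists y, y \notin [set dot v b^f | b : 'rV[K]_n].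
  apply/existsP; rewrite -negb_forall; apply: contraL n4 => /forallP allP.
  rewrite -leqNgt -(leq_exp2l _ _ (finNzRing_gt1 K)) -cardF.
  have /subset_leq_card/leq_trans-> // : F \subset [set dot v b^f | b : 'rV[K]_n].
    by apply/subsetP => y _; apply: allP.
  by rewrite (leq_trans (leq_imset_card _ _)) // card_mx mul1n.
suff: exists v : 'rV[F]_(1 + n),
  forall b : 'rV[K]_(1 + n), dot v b^f = 0 -> b = 0 by [].
exists (row_mx (const_mx y) v) => b.
rewrite -[b]hsubmxK; move: (lsubmx _) (rsubmx _) => b1 b2.
rewrite map_row_mx dot_row_mx {1}/dot big_ord1 !mxE.
have [b10|b10] := eqVneq (b1 0 0) 0.
  rewrite b10 rmorph0 mulr0 add0r => /vP->.
  by apply/eqP; rewrite row_mx_eq0 eqxx andbT; apply/eqP/rowP=> i; rewrite ord1 mxE.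
move/eqP; rewrite addr_eq0 => /eqP yE; case/negP: yP.
apply/imsetP; exists (- (b1 0 0)^-1 *: b2) => //.
have fb0 : f (b1 0 0) != 0 by rewrite fmorph_eq0.
apply: (mulIf fb0); rewrite yE /dot mulr_suml -sumrN; apply: eq_bigr => i _.
by rewrite !mxE rmorphM rmorphN fmorphV; field.
Qed.

Fact vline_default_subproof : \dim <[delta_mx 0%R 0%R : 'rV[F]_5]>%VS == 1%N.
Proof.
rewrite dim_vline; suff -> : (delta_mx 0 0 : 'rV[F]_5) != 0 by [].
by apply/eqP => /rowP/(_ 0)/eqP; rewrite !mxE oner_eq0.
Qed.

(** The zero vector gets a default point; [rational_set] below excludes it. *)
Definition PG_pt (v : 'rV[F]_5) : PG_point F 4 :=
  insubd (exist _ <[delta_mx 0%R 0%R]>%VS vline_default_subproof : PG_point F 4)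
    <[v]>%VS.

Lemma val_PG_pt v : v != 0 -> val (PG_pt v) = <[v]>%VS.
Proof. by move=> v0; rewrite val_insubd dim_vline v0. Qed.

Lemma PG_pointP (P : PG_point F 4) : exists2 v, v != 0 & P = PG_pt v.
Proof.
have dP := eqP (valP P); exists (vpick (val P)).
  by rewrite vpick0 -dimv_eq0 dP.
have v0 : vpick (val P) != 0 by rewrite vpick0 -dimv_eq0 dP.
apply: val_inj; rewrite val_PG_pt //; apply/esym/eqP.
by rewrite eqEdim dP dim_vline v0 andbT -memvE memv_pick.
Qed.

Definition rows_mx (B : {set 'rV[K]_5}) : 'M[K]_(#|B|, 5) :=
  \matrix_i enum_val i.

Lemma mem_rows_mx (B : {set 'rV[K]_5}) x : x \in B -> exists i, x = row i (rows_mx B).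
Proof. by move=> xB; exists (enum_rank_in xB x); rewrite rowK enum_rankK_in. Qed.

Lemma cokermx_rows (B : {set 'rV[K]_5}) x j : x \in B ->
  dot (\row_k cokermx (rows_mx B) k j) x = 0.
Proof.
case/mem_rows_mx => i ->; have /matrixP/(_ i j) := mulmx_coker (rows_mx B).
rewrite mxE [RHS]mxE => <-; apply: eq_bigr => k _.
by rewrite [X in X * _]mxE [row _ _ _ _]mxE mulrC.
Qed.

(** Cokernels commute with field extension, so the equations of the span over [K] also cut out the
    span over [F]. *)
Lemma sub_map_rowsP (B : {set 'rV[K]_5}) (v : 'rV[F]_5) :
  reflect (forall j, dot v (\row_k cokermx (rows_mx B) k j)^f = 0)
          (v <= (rows_mx B)^f)%MS.
Proof.
rewrite submxE -map_cokermx; apply: (iffP eqP) => [/rowP vC j|vC].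
  have := vC j; rewrite mxE [RHS]mxE => <-.
  by apply: eq_bigr => k _; rewrite !mxE.
apply/rowP => j; rewrite mxE [RHS]mxE -[RHS](vC j).
by apply: eq_bigr => k _; rewrite !mxE.
Qed.

Lemma rank_le_dimv m n (A : 'M[F]_(m, n)) (U : {vspace 'rV[F]_n}) :
  (forall i, row i A \in U) -> (\rank A <= \dim U)%N.
Proof.
move=> AU; pose g : 'Hom('rV_(\rank A), 'rV_n) := linfun (mulmxr (row_base A)).
have subU (w : 'rV_n) : (w <= A)%MS -> w \in U.
  case/submxP => D ->; rewrite mulmx_sum_row.
  by apply: rpred_sum => i _; apply: rpredZ.
have kg : (lker g == 0)%VS.
  apply/lker0P => x y; rewrite !lfunE /=.
  exact: (row_free_inj (row_base_free A)).
have /subvP/dimvS : {subset limg g <= U}.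
  move=> _ /memv_imgP[w _ ->]; rewrite lfunE /=; apply: subU.
  by rewrite -(eq_row_base A) submxMl.
by rewrite limg_dim_eq ?(eqP kg) ?capv0 // dimvf dim_matrix mul1r.
Qed.

Variable s : seq 'rV[K]_5.

Definition rational_set (B : {pred 'rV[K]_5}) : {set PG_point F 4} :=
  [set PG_pt x^f | x in [pred x in s | (x != 0) && (x \in B)]].

Lemma rational_set_subset B : rational_set B \subset rational_set predT.
Proof.
by apply: imsetS; apply/subsetP => x; rewrite !inE => /and3P[-> ->].
Qed.

Lemma card_rational_set B : (#|rational_set B| <= size s)%N.
Proof.
rewrite (leq_trans (leq_imset_card _ _)) // (leq_trans _ (card_size s)) //.
by apply/subset_leq_card/subsetP => x; rewrite inE => /andP[].
Qed.

Lemma span_rational_setP B w : w \in PG_span (rational_set B) ->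
  (w <= (rows_mx [set x in s | (x != 0) && B x])^f)%MS.
Proof.
case/memv_sumP => z zP ->; apply: summx_sub => X XT; case/imsetP: (XT) => x.
rewrite inE => /and3P[xs x0 xB] XE; have := zP _ XT; rewrite XE.
rewrite val_PG_pt ?map_mx_eq0 // => /vlineP[c ->]; apply: scalemx_sub.
have /mem_rows_mx[i xE] : x \in [set x in s | (x != 0) && B x].
  by rewrite inE xs x0.
by rewrite xE map_row row_sub.
Qed.

Lemma mem_span_rational_set (B : {pred 'rV[K]_5}) x :
  x \in s -> x \in B -> x^f \in PG_span (rational_set B).
Proof.
move=> xs xB; have [->|x0] := eqVneq x 0; first by rewrite map_mx0 mem0v.
apply: (subvP (sumv_sup (PG_pt x^f) _ (subvv _))).
  by apply/imsetP; exists x; rewrite // inE xs x0.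
by rewrite val_PG_pt ?map_mx_eq0 // memv_line.
Qed.

Lemma span_rational_set_mem (B : {pred 'rV[K]_5}) w :
  (w <= (rows_mx [set x in s | (x != 0) && B x])^f)%MS ->
  w \in PG_span (rational_set B).
Proof.
case/submxP => D ->; rewrite mulmx_sum_row; apply: rpred_sum => i _.
apply: rpredZ; rewrite -map_row rowK.
have := enum_valP i; rewrite inE => /and3P[ys _ yB].
exact: mem_span_rational_set.
Qed.

Lemma strong_blocking_saturates :
  strong_blocking s -> saturates_all 3 (rational_set predT).
Proof.
move=> sB; apply/forallP => P; have [v v0 ->] := PG_pointP P.
have [u u0 uv] := exists_rational_relation v isT.
have [i ui] : exists i, u 0 i != 0.
  apply/existsP; apply: contraNT u0; rewrite negb_exists => /forallP u0.
  by apply/eqP/rowP => i; rewrite mxE; apply/eqP; have := u0 i; rewrite negbK.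
pose B := [pred x | dot u x == 0]; pose W := PG_span (rational_set B).
apply/existsP; exists (rational_set B); rewrite rational_set_subset /=.
have Wu w : w \in W -> dot w u^f = 0.
  case/memv_sumP => z zT ->; rewrite dot_suml big1 // => X XT.
  case/imsetP: (XT) => x.
  rewrite inE => /and3P[xs x0 /eqP ux] XE; have := zT _ XT; rewrite XE.
  rewrite val_PG_pt ?map_mx_eq0 // => /vlineP[c ->].
  by rewrite dotZl dotC dot_map ux rmorph0 mulr0.
apply/andP; split.
  rewrite leqNgt; apply/negP => W5; have WT : W = fullv.
    by apply/eqP; rewrite eqEdim subvf dimvf dim_matrix.
  have := Wu (delta_mx 0 i); rewrite WT memvf dotC dot_delta mxE.
  by move=> /(_ isT)/eqP; rewrite fmorph_eq0; apply/negP.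
(* Each rational equation [b] of the selected points is parallel to [u] by strong blocking, hence
   holds at [v]. *)
rewrite val_PG_pt // -memvE; apply: span_rational_set_mem.
apply/sub_map_rowsP => j; set b := \row_k _.
have ub : forall i j, u 0 i * b 0 j = u 0 j * b 0 i.
  apply: sB => x xs ux; have [->|x0] := eqVneq x 0.
    by rewrite -(scale0r 0) dotC dotZl mul0r.
  by apply: cokermx_rows; rewrite inE xs x0 inE ux eqxx.
have fui : f (u 0 i) != 0 by rewrite fmorph_eq0.
apply: (mulfI fui); rewrite mulr0 -[RHS](mul0r (f (b 0 i))) -uv /dot.
rewrite mulr_sumr mulr_suml; apply: eq_bigr => k _.
by rewrite [b^f 0 k]mxE [u^f 0 k]mxE mulrCA -rmorphM ub rmorphM mulrA.
Qed.

(** For [v = (0, x)] with [x] free over [K], the rational relations form a space of dimension 1. So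
    rational points whose span contains [v] have rank at least 4. *)
Lemma rational_set_not_saturates r :
  (r < 3)%N -> ~~ saturates_all r (rational_set predT).
Proof.
move=> r3; apply/negP => /forallP satr.
have [x xP] := exists_rationally_free (leqnn 4).
pose v : 'rV[F]_(1 + 4) := row_mx 0 x.
have vP (b : 'rV[K]_(1 + 4)) : dot v b^f = 0 -> rsubmx b = 0.
  rewrite -{1}[b]hsubmxK map_row_mx dot_row_mx {1}/dot big1 ?add0r.
    exact: xP.
  by move=> i _; rewrite mxE mul0r.
have v0 : v != 0.
  apply/eqP => v0; have := vP (const_mx 1); rewrite v0 {1}/dot big1.
    by move=> /(_ erefl)/rowP/(_ 0)/eqP; rewrite !mxE oner_eq0.
  by move=> i _; rewrite mxE mul0r.
have /existsP[T /and3P[/subsetP TS dT]] := satr (PG_pt v).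
rewrite val_PG_pt // -memvE => vT.
(* [B] presents the arbitrary subset [T] by rational vectors. *)
pose B := [pred x : 'rV[K]_5 | PG_pt x^f \in T].
have TE : T = rational_set B.
  apply/setP => X; apply/idP/imsetP => [XT|[y]]; last first.
    by rewrite inE => /and3P[_ _ yB] ->.
  have /imsetP[y] := TS _ XT; rewrite inE => /and3P[ys y0 _] XE.
  by exists y; rewrite // !inE ys y0 -XE.
rewrite TE in vT dT; move: (span_rational_setP vT).
set A := rows_mx _ => /sub_map_rowsP vC.
have rA : (\rank A <= 3)%N.
  rewrite -(mxrank_map f); apply: leq_trans (leq_trans dT r3).
  apply: rank_le_dimv => i; rewrite -map_row rowK.
  have := enum_valP i; rewrite inE => /and3P[ys _ yB].
  exact: mem_span_rational_set.
have rC : (\rank (cokermx A) <= 1)%N.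
  set C : 'M_(1 + 4, 5) := cokermx A.
  have dC0 : dsubmx C = 0.
    apply/matrixP => i j; rewrite [RHS]mxE.
    have /rowP/(_ i) := vP _ (vC j); rewrite [dsubmx _ _ _]mxE.
    by rewrite !mxE.
  rewrite -[C]vsubmxK dC0 -[usubmx C]mul1mx -(mul0mx 4 (usubmx C)) -mul_col_mx.
  exact: leq_trans (mxrankM_maxr _ _) (rank_leq_row _).
by move: rC; rewrite mxrank_coker; move: rA; lia.
Qed.

Lemma saturation_number_le_strong_blocking :
  strong_blocking s -> (saturation_number F 4 3 <= size s)%N.
Proof.
move=> sB; apply: leq_trans (card_rational_set predT).
apply: saturation_number_le; rewrite /saturating_set strong_blocking_saturates //.
by apply/forallP => r; apply: rational_set_not_saturates.
Qed.

End RationalPoints.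

Local Close Scope ring_scope.

Theorem mainTheorem9 (q : nat)
    (hq : exists p k : nat, [/\ prime p, 0 < k & q = p ^ k])
    (F : finFieldType) (hF : #|F| = q ^ 4) :
  saturation_number F 4 3 <= 6 * q + 5.
Proof.
case: hq => p [k [p_pr _ qE]]; rewrite qE in hF.
have [K [f]] := exists_subfield p_pr hF; rewrite -qE => cardK.
have cardF : #|F| = #|K| ^ 4 by rewrite hF cardK qE.
have [q2|K2] := leqP #|K| 2.
  have {}q2 : #|K| = 2 by apply/eqP; rewrite eqn_leq q2 finNzRing_gt1.
  have := saturation_number_le_strong_blocking f cardF
    (@tetrahedron_strong_blocking K 5 q2).
  (* Here [15 <= 6 * 2 + 5 = 17]. *)
  by rewrite size_tetrahedron5 -cardK q2 => /leq_trans->.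
have [s [sB sE]] := six_lines_strong_blocking K2.
have := saturation_number_le_strong_blocking f cardF sB.
by rewrite sE cardK.
Qed.
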